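(* Let $\mathcal{M}'': z(u,v)=f(u)\,l(v)+g(u)\,e_4$, $u\in I$, $v\in J$, be a meridian surface of type $\mathcal{M}''$ in $\mathbb{E}^4_2$ (so $l$ is a unit-speed curve on $\mathbb{H}^2_1(-1)\subset\mathbb{E}^3_1$ and $f'^2+g'^2=1$). Then $\mathcal{M}''$ has non-zero constant mean curvature, i.e. $\langle H,H\rangle=c=\mathrm{const}$, $c\neq0$, if and only if the curve $l$ has constant curvature $\kappa=a=\mathrm{const}$, $a\neq0$, and the meridian curve $u\mapsto(f(u),g(u))$ is determined by $f'=\varphi(f)$, where $$\varphi(t)=\pm\frac1t\sqrt{t^2-\left(b\mp\frac t2\sqrt{a^2-4ct^2}\mp\frac{a^2}{4\sqrt c}\arcsin\frac{2\sqrt c\,t}{a}\right)^2}\quad\text{if } c>0,$$ $$\varphi(t)=\pm\frac1t\sqrt{t^2-\left(b\mp\frac t2\sqrt{a^2-4ct^2}\mp\frac{a^2}{4\sqrt{-c}}\ln\left|2\sqrt{-c}\,t+\sqrt{a^2-4ct^2}\right|\right)^2}\quad\text{if } c<0,$$ $b=\mathrm{const}$, and $g(u)$ is defined by $g'=\sqrt{1-f'^2}$.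
   Context: $\mathbb{E}^4_2$ is $\mathbb{R}^4$ with the inner product $\langle x,y\rangle=x_1y_1+x_2y_2-x_3y_3-x_4y_4$ and standard basis $e_1,e_2,e_3,e_4$. Let $\mathbb{E}^3_1=\mathrm{span}\{e_1,e_2,e_3\}$ and $\mathbb{H}^2_1(-1)=\{V\in\mathbb{E}^3_1:\langle V,V\rangle=-1\}$ (curves are taken in the part parametrized by $\sinh w^1\cos w^2\,e_1+\sinh w^1\sin w^2\,e_2+\cosh w^1\,e_3$). Meridian surface of type $\mathcal{M}''$: let $I,J\subset\mathbb{R}$ be intervals, $f,g:I\to\mathbb{R}$ smooth with $f$ nowhere zero, $f'^2+g'^2=1$ and $g'>0$; let $l:J\to\mathbb{H}^2_1(-1)$ be a smooth curve with $\langle l',l'\rangle=1$. The surface is $z(u,v)=f(u)l(v)+g(u)e_4$. Its induced metric is Lorentzian, with orthonormal tangent frame $X=z_u$, $Y=z_v/f=l'$, $\langle X,X\rangle=-1$, $\langle Y,Y\rangle=1$. Curvature of $l$: put $t=l'$ and let $n$ be a vector field along $l$ (unique up to sign) such that $\{l,t,n\}$ is an orthonormal frame of $\mathbb{E}^3_1$ with $\langle l,l\rangle=-1$, $\langle t,t\rangle=\langle n,n\rangle=1$; then $\kappa(v)=\langle t'(v),n(v)\rangle$, so that $t'=\kappa n+l$, $n'=-\kappa t$. For a Lorentz surface with second fundamental form $h$, the mean curvature vector field is $H=\tfrac12\,\mathrm{tr}\,h=\tfrac12\left(h(E_1,E_1)-h(E_2,E_2)\right)$ for any local orthonormal tangent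 frame with $\langle E_1,E_1\rangle=1$, $\langle E_2,E_2\rangle=-1$. ''$f'=\varphi(f)$'' means $f'(u)=\varphi(f(u))$.
   Formalization: For ''only if'' with c<0, κ is assumed not identically 0 (else f=sin(ru)/r, κ=0 is a counterexample); for ''if'', f is assumed nonconstant (constant f solves f'=φ(f) for unrelated c); φ uses |a| for a, and its outer sign may vary with u. *)

(* Defs.v *)
From Stdlib Require Import Reals Lra.
From Coquelicot Require Import Coquelicot.
Open Scope R_scope.

(** * The ambient space *)

(** The canonical instances on products provide [plus], [minus], [scal]. *)
Notation E42 := (R * R * R * R)%type.

Definition inner (x y : E42) : R :=
  let '(x1, x2, x3, x4) := x in
  let '(y1, y2, y3, y4) := y in
  x1 * y1 + x2 * y2 - x3 * y3 - x4 * y4.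

Definition e4 : E42 := (0, 0, 0, 1).

Definition in_E31 (x : E42) : Prop := snd x = 0.

(** The second clause selects the sheet of the hyperboloid covered by the
    parametrization. *)
Definition in_H21 (x : E42) : Prop :=
  (in_E31 x /\ inner x x = -1) /\
  (exists w1 w2 : R, x = (sinh w1 * cos w2, sinh w1 * sin w2, cosh w1, 0)).

(** * Intervals, smoothness, derivatives of curves *)

Definition is_interval (I : R -> Prop) : Prop :=
  (forall x y w, I x -> I y -> x <= w <= y -> I w) /\
  (exists x y, I x /\ I y /\ x < y).

(** Functions on an interval are restrictions of total functions.  On an open
    interval the values outside it are irrelevant; at an endpoint belonging
    to the interval, smoothness is that of an extension across it. *)
Definition smooth_on (I : R -> Prop) (f : R -> R) : Prop :=
  forall (k : nat) (u : R), I u -> ex_derive_n f k u.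

Definition coord1 (x : E42) : R := fst (fst (fst x)).
Definition coord2 (x : E42) : R := snd (fst (fst x)).
Definition coord3 (x : E42) : R := snd (fst x).
Definition coord4 (x : E42) : R := snd x.

Definition smooth_curve_on (J : R -> Prop) (l : R -> E42) : Prop :=
  smooth_on J (fun v => coord1 (l v)) /\ smooth_on J (fun v => coord2 (l v)) /\
  smooth_on J (fun v => coord3 (l v)) /\ smooth_on J (fun v => coord4 (l v)).

Definition Dcurve (l : R -> E42) (v : R) : E42 :=
  (Derive (fun s => coord1 (l s)) v, Derive (fun s => coord2 (l s)) v,
   Derive (fun s => coord3 (l s)) v, Derive (fun s => coord4 (l s)) v).

(** * Mean curvature of a Lorentz surface [z u v] *)

Definition z_u (z : R -> R -> E42) (u v : R) : E42 := Dcurve (fun s => z s v) u.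
Definition z_v (z : R -> R -> E42) (u v : R) : E42 := Dcurve (fun s => z u s) v.
Definition z_uu (z : R -> R -> E42) : R -> R -> E42 := z_u (z_u z).
Definition z_uv (z : R -> R -> E42) : R -> R -> E42 := z_v (z_u z).
Definition z_vv (z : R -> R -> E42) : R -> R -> E42 := z_v (z_v z).

(** The component of [w] orthogonal to the plane spanned by [x] and [y], when
    the inner product is nondegenerate on that plane: the coefficients solve
    the linear system given by the Gram matrix of [x], [y]. *)
Definition normal_part (x y w : E42) : E42 :=
  let E := inner x x in
  let F := inner x y in
  let G := inner y y in
  minus w
    (plus (scal ((G * inner w x - F * inner w y) / (E * G - F ^ 2)) x)
          (scal ((E * inner w y - F * inner w x) / (E * G - F ^ 2)) y)).

(** A tangent vector at [(u, v)] is given by its coordinates [(p, q)] in the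
    basis [z_u], [z_v]. *)
Definition tangent (z : R -> R -> E42) (u v : R) (T : R * R) : E42 :=
  plus (scal (fst T) (z_u z u v)) (scal (snd T) (z_v z u v)).

Definition second_form (z : R -> R -> E42) (u v : R) (S T : R * R) : E42 :=
  normal_part (z_u z u v) (z_v z u v)
    (plus (scal (fst S * fst T) (z_uu z u v))
    (plus (scal (fst S * snd T + snd S * fst T) (z_uv z u v))
          (scal (snd S * snd T) (z_vv z u v)))).

Definition orthonormal_frame (z : R -> R -> E42) (u v : R) (E1 E2 : R * R) : Prop :=
  inner (tangent z u v E1) (tangent z u v E1) = 1 /\
  inner (tangent z u v E2) (tangent z u v E2) = -1 /\
  inner (tangent z u v E1) (tangent z u v E2) = 0.

Definition mean_curvature_vector
    (z : R -> R -> E42) (u v : R) (E1 E2 : R * R) : E42 :=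
  scal (1 / 2) (minus (second_form z u v E1 E1) (second_form z u v E2 E2)).

Definition constant_mean_curvature
    (I J : R -> Prop) (z : R -> R -> E42) (c : R) : Prop :=
  forall u v, I u -> J v ->
  forall E1 E2, orthonormal_frame z u v E1 E2 ->
  let H := mean_curvature_vector z u v E1 E2 in inner H H = c.

(** * Meridian surfaces of type M'' *)

Record is_meridian_data (I J : R -> Prop) (f g : R -> R) (l : R -> E42) : Prop := {
  md_I : is_interval I;
  md_J : is_interval J;
  md_f_smooth : smooth_on I f;
  md_g_smooth : smooth_on I g;
  md_f_neq0 : forall u, I u -> f u <> 0;
  md_arclength : forall u, I u -> (Derive f u) ^ 2 + (Derive g u) ^ 2 = 1;
  md_g'_pos : forall u, I u -> 0 < Derive g u;
  md_l_smooth : smooth_curve_on J l;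
  md_l_H21 : forall v, J v -> in_H21 (l v);
  md_l_unit : forall v, J v -> inner (Dcurve l v) (Dcurve l v) = 1
}.

Definition meridian_surface (f g : R -> R) (l : R -> E42) (u v : R) : E42 :=
  plus (scal (f u) (l v)) (scal (g u) e4).

Record is_unit_normal (J : R -> Prop) (l n : R -> E42) : Prop := {
  un_smooth : smooth_curve_on J n;
  un_E31 : forall v, J v -> in_E31 (n v);
  un_unit : forall v, J v -> inner (n v) (n v) = 1;
  un_l : forall v, J v -> inner (n v) (l v) = 0;
  un_t : forall v, J v -> inner (n v) (Dcurve l v) = 0
}.

Definition kappa (l n : R -> E42) (v : R) : R := inner (Dcurve (Dcurve l) v) (n v).

(** * The function phi *)

Definition is_sign (s : R) : Prop := s = 1 \/ s = -1.

(** The expression that is squared inside [phi]; [s] carries the inner signs,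
    which are the same in both terms.  Only used for [c <> 0]. *)
Definition phi_inner (c a b s t : R) : R :=
  if Rlt_dec 0 c then
    b - s * (t / 2 * sqrt (a ^ 2 - 4 * c * t ^ 2))
      - s * (a ^ 2 / (4 * sqrt c) * asin (2 * sqrt c * t / a))
  else
    b - s * (t / 2 * sqrt (a ^ 2 - 4 * c * t ^ 2))
      - s * (a ^ 2 / (4 * sqrt (- c))
             * ln (Rabs (2 * sqrt (- c) * t + sqrt (a ^ 2 - 4 * c * t ^ 2)))).

Definition phi (c a b r s t : R) : R :=
  r * (1 / t * sqrt (t ^ 2 - (phi_inner c a b s t) ^ 2)).

(** Where the formula for [phi] is meaningful: [sqrt] and [asin] are total
    functions in the library, so this has to be required separately.  The
    first condition also puts the argument of [asin] in [[-1, 1]]. *)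
Definition phi_dom (c a b s t : R) : Prop :=
  t <> 0 /\ 0 <= a ^ 2 - 4 * c * t ^ 2 /\ 0 <= t ^ 2 - (phi_inner c a b s t) ^ 2.

(** [f' = phi (f)] and [g' = sqrt (1 - f'^2)].  The inner sign and [b] are
    fixed along the meridian.  The outer sign is the sign of [f f'], which
    changes when the meridian passes through an extremum of [f]; hence it may
    depend on [u].  By continuity it is constant wherever [f'] has no zero. *)
Definition meridian_determined (I : R -> Prop) (f g : R -> R) (c a : R) : Prop :=
  exists b s : R, is_sign s /\
  forall u, I u ->
    phi_dom c a b s (f u) /\
    (exists r, is_sign r /\ Derive f u = phi c a b r s (f u)) /\
    Derive g u = sqrt (1 - (Derive f u) ^ 2).

(** The curvature changes sign with [n], and the [asin] term of [phi] is odd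
    in [a]: the function [phi] is the one of the orientation of [n] for which
    the curvature is positive, that is [|a|]. *)
Definition curvature_and_meridian
    (I J : R -> Prop) (f g : R -> R) (l n : R -> E42) (c : R) : Prop :=
  exists a : R, a <> 0 /\
    (forall v, J v -> kappa l n v = a) /\
    meridian_determined I f g c (Rabs a).

(** [l] is not a geodesic of the hyperboloid.  If it is, the surface lies in
    a hyperplane and can have [<H,H> = c] for [c < 0], for instance with
    [f u = sin (r u) / r], [c = - r ^ 2]. *)
Definition curvature_not_identically_0 (J : R -> Prop) (l n : R -> E42) : Prop :=
  exists v, J v /\ kappa l n v <> 0.

(** Excludes the equilibria of [f' = phi (f)]: for any constant [f] and any
    [c] with [4 c f ^ 2 <= a ^ 2] some [b] gives [phi (f) = 0], whereas then
    [<H,H> = (a ^ 2 - 1) / (4 f ^ 2)]. *)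
Definition nonconstant_on (I : R -> Prop) (f : R -> R) : Prop :=
  exists u u', I u /\ I u' /\ f u <> f u'.

(* Main.v *)
Require Import Defs.
From Stdlib Require Import Reals Lra.
From Coquelicot Require Import Coquelicot.
Open Scope R_scope.

(** Put [W = g' - f f'' / g'].  In the normal frame formed by [n] and
    [- g' l + f' e4], the components of [2 f H] are [kappa] and [W] up to sign, so that
    [<H,H> = (kappa^2 - W^2) / (4 f^2)].  Hence [<H,H> = c] separates the variables:
    [kappa^2] is a constant [a^2], and [W^2 = a^2 - 4 c f^2].  Since [(f g')' = f' W],
    the latter equation, with the sign of [W] fixed, integrates to
    [f g' = b - s * (primitive of sqrt (a^2 - 4 c t^2)) (f)]; by [f'^2 + g'^2 = 1]
    this is [f' = phi (f)].  The sign is fixed because [W] has no zero: at a zero one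
    would have [f' = 0], [f f'' = 1] and [W'^2 = - 4 c].  Conversely, differentiating
    [phi_inner (f) ^ 2 = (f g')^2] gives [f' E = 0] for [E = W^2 - (a^2 - 4 c f^2)];
    wherever [E] is not zero, [f] and hence [E] are locally constant, so [E] is zero
    unless [f] is constant. *)

(** * Calculus on an interval *)

(* [auto_derive] leaves eta-expanded functions, which [ring] and [field] do not
   identify with the functions themselves. *)
Ltac derive_eta :=
  repeat match goal with
  | |- context [Derive (fun x => ?F x)] =>
      change (Derive (fun x => F x)) with (Derive F)
  end.

(** The point [u] may be an endpoint of [I], where [F] is known to vanish on one side only. The
    derivative is two-sided, so difference quotients with steps that stay in [I] suffice to find it.
    This is what allows an identity valid on [I] alone to be differentiated. *)
Lemma interval_derive_zero (I : R -> Prop) (F : R -> R) (u d : R) :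
  is_interval I -> (forall x, I x -> F x = 0) -> I u -> is_derive F u d -> d = 0.
Proof.
intros [conv [x [y [Ix [Iy xy]]]]] F0 Iu dF.
assert (Hw : exists w, I w /\ w <> u).
{ destruct (Req_dec x u) as [e|ne]; [exists y; split; [easy|lra] | now exists x]. }
destruct Hw as [w [Iw wu]].
apply is_derive_Reals in dF.
destruct (Req_dec d 0) as [e|nd]; [easy|exfalso].
destruct (dF (Rabs d) (Rabs_pos_lt _ nd)) as [delta Hd].
(* A step from [u] towards [w], shorter than [delta] and not going beyond [w], stays in [I] by
   convexity. *)
assert (Hh : exists h, h <> 0 /\ Rabs h < delta /\ I (u + h)).
{ destruct delta as [dl dl0]; simpl.
  destruct (Rlt_dec u w) as [lt|ge].
  - exists (Rmin (w - u) (dl / 2)).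
    pose proof (Rmin_l (w - u) (dl / 2)). pose proof (Rmin_r (w - u) (dl / 2)).
    assert (0 < Rmin (w - u) (dl / 2)) by (apply Rmin_glb_lt; lra).
    rewrite Rabs_pos_eq by lra.
    repeat split; try lra. apply (conv u w); auto; lra.
  - exists (- Rmin (u - w) (dl / 2)).
    pose proof (Rmin_l (u - w) (dl / 2)). pose proof (Rmin_r (u - w) (dl / 2)).
    assert (0 < Rmin (u - w) (dl / 2)) by (apply Rmin_glb_lt; lra).
    rewrite Rabs_Ropp, Rabs_pos_eq by lra.
    repeat split; try lra. apply (conv w u); auto; lra. }
destruct Hh as [h [h0 [hd Ih]]].
specialize (Hd h h0 hd).
rewrite (F0 _ Ih), (F0 _ Iu) in Hd.
replace ((0 - 0) / h - d) with (- d) in Hd by (field; easy).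
rewrite Rabs_Ropp in Hd; lra.
Qed.

Lemma interval_derive_eq (I : R -> Prop) (F G : R -> R) (u d e : R) :
  is_interval I -> (forall x, I x -> F x = G x) -> I u ->
  is_derive F u d -> is_derive G u e -> d = e.
Proof.
intros HI FG Iu dF dG.
assert (d - e = 0); [|lra].
apply (interval_derive_zero I (fun x => F x - G x) u); auto.
- intros x Ix; rewrite (FG x Ix); ring.
- apply (is_derive_minus F G u d e dF dG).
Qed.

Lemma interval_derive_0_constant (I : R -> Prop) (F : R -> R) :
  is_interval I -> (forall x, I x -> is_derive F x 0) ->
  forall x y, I x -> I y -> F x = F y.
Proof.
intros [conv _] dF.
assert (lt : forall x y, I x -> I y -> x < y -> F x = F y).
{ intros x y Ix Iy xy; apply eq_is_derive; auto.
  intros t Ht; apply dF, (conv x y); auto. }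
intros x y Ix Iy; destruct (Rtotal_order x y) as [h|[h|h]].
- now apply lt.
- now subst.
- symmetry; now apply lt.
Qed.

(** If [k] is not zero, 2 F F' = 0 forces F' = 0. The lemma excludes jumps of sign; it serves for
    [kappa] and for the sign of [meridian_W]. *)
Lemma interval_square_constant (I : R -> Prop) (F : R -> R) (k : R) :
  is_interval I -> (forall x, I x -> ex_derive F x) ->
  (forall x, I x -> F x ^ 2 = k) ->
  forall x y, I x -> I y -> F x = F y.
Proof.
intros HI dF Fk x y Ix Iy.
destruct (Req_dec k 0) as [k0|k0].
- pose proof (Fk x Ix); pose proof (Fk y Iy).
  rewrite (Rsqr_0_uniq (F x)), (Rsqr_0_uniq (F y)); auto; unfold Rsqr; lra.
- apply (interval_derive_0_constant I); auto.
  intros z Iz.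
  assert (dz : 2 * F z * Derive F z = 0).
  { apply (interval_derive_eq I (fun u => F u ^ 2) (fun _ => k) z); auto.
    - auto_derive; [auto|]. derive_eta; ring.
    - auto_derive; auto. }
  replace 0 with (Derive F z); [now apply Derive_correct, dF|].
  apply Rmult_integral in dz as [dz|dz]; auto.
  exfalso; apply k0; rewrite <- (Fk z Iz). replace (F z) with 0 by lra; ring.
Qed.

Lemma smooth_on_ex_derive (I : R -> Prop) (f : R -> R) (u : R) :
  smooth_on I f -> I u -> ex_derive f u.
Proof. intros Hf Iu; exact (Hf 1%nat u Iu). Qed.

Lemma smooth_on_Derive (I : R -> Prop) (f : R -> R) :
  smooth_on I f -> smooth_on I (Derive f).
Proof.
intros Hf k u Iu; specialize (Hf (S k) u Iu).
destruct k as [|k]; [exact Logic.I|].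
apply (ex_derive_ext (Derive_n f (S k))); [|exact Hf].
intros t; rewrite <- Nat.add_1_r; symmetry; exact (Derive_n_comp f k 1 t).
Qed.

(** * The function under the square in phi *)

Lemma is_derive_asin (x : R) : -1 < x < 1 -> is_derive asin x (/ sqrt (1 - x ^ 2)).
Proof.
intros Hx; apply is_derive_Reals.
replace (/ sqrt (1 - x ^ 2)) with (derive_pt asin x (derivable_pt_asin x Hx)).
- apply (proj2_sig (derivable_pt_asin x Hx)).
- rewrite derive_pt_asin; unfold Rdiv; rewrite Rmult_1_l, <- Rsqr_pow2; reflexivity.
Qed.

(** The terms after [b] are [- s] times a primitive of sqrt (a^2 - 4 c t^2), with an arcsine for c >
    0 and a logarithm for c < 0. The strict inequality keeps [t] away from the points where [sqrt]
    and [asin] fail to be derivable. *)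
Lemma is_derive_phi_inner (c a b s t : R) :
  c <> 0 -> 0 < a -> 0 < a ^ 2 - 4 * c * t ^ 2 ->
  is_derive (phi_inner c a b s) t (- s * sqrt (a ^ 2 - 4 * c * t ^ 2)).
Proof.
intros c0 a0 q0.
pose proof (sqrt_lt_R0 _ q0) as sq0.
pose proof (pow2_sqrt _ (Rlt_le _ _ q0)) as sq2.
unfold phi_inner; destruct (Rlt_dec 0 c) as [cp|cn].
- pose proof (sqrt_lt_R0 _ cp) as sc0.
  pose proof (pow2_sqrt _ (Rlt_le _ _ cp)) as sc2.
  (* Being positive, this quantity puts the argument of [asin] strictly between -1 and 1; its root
     gives the derivative of [asin] there. *)
  assert (x2 : 1 - (2 * sqrt c * t / a) ^ 2 = (sqrt (a ^ 2 - 4 * c * t ^ 2) / a) ^ 2).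
  { transitivity ((a ^ 2 - 4 * (sqrt c ^ 2) * t ^ 2) / a ^ 2); [field; lra|].
    rewrite sc2; rewrite <- sq2 at 1; field; lra. }
  assert (qa : 0 < sqrt (a ^ 2 - 4 * c * t ^ 2) / a) by (apply Rdiv_lt_0_compat; lra).
  assert (dasin : is_derive asin (2 * sqrt c * t / a) (a / sqrt (a ^ 2 - 4 * c * t ^ 2))).
  { replace (a / sqrt (a ^ 2 - 4 * c * t ^ 2))
      with (/ sqrt (1 - (2 * sqrt c * t / a) ^ 2)).
    - apply is_derive_asin. split; nra.
    - rewrite x2, sqrt_pow2 by lra; field; lra. }
  auto_derive.
  + split; [lra|]. split; [|exact Logic.I]. exists (a / sqrt (a ^ 2 - 4 * c * t ^ 2)); exact dasin.
  + replace (a * (a * 1) + - (4 * c * (t * (t * 1)))) with (a ^ 2 - 4 * c * t ^ 2) by ring.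
    replace (2 * sqrt c * t * / a) with (2 * sqrt c * t / a) by reflexivity.
    derive_eta; rewrite (is_derive_unique _ _ _ dasin).
    assert (a2 : a ^ 2 = sqrt (a ^ 2 - 4 * c * t ^ 2) ^ 2 + 4 * c * t ^ 2) by lra.
    set (q := sqrt _) in *.
    field_simplify; try lra.
    replace (a ^ 2) with (q ^ 2 + 4 * c * t ^ 2) by lra.
    field; lra.
- assert (mc0 : 0 < - c) by lra.
  pose proof (sqrt_lt_R0 _ mc0) as sc0.
  pose proof (pow2_sqrt _ (Rlt_le _ _ mc0)) as sc2.
  assert (pos : forall x, 0 < 2 * sqrt (- c) * x + sqrt (a ^ 2 - 4 * c * x ^ 2)).
  { intros x.
    assert (qx : 0 < a ^ 2 - 4 * c * x ^ 2) by nra.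
    pose proof (sqrt_lt_R0 _ qx) as sqx.
    pose proof (pow2_sqrt _ (Rlt_le _ _ qx)) as sqx2.
    assert ((2 * sqrt (- c) * x) ^ 2 < sqrt (a ^ 2 - 4 * c * x ^ 2) ^ 2).
    { rewrite sqx2.
      replace ((2 * sqrt (- c) * x) ^ 2) with (4 * (sqrt (- c) ^ 2) * x ^ 2) by ring.
      rewrite sc2; nra. }
    nra. }
  apply (is_derive_ext (fun t => b - s * (t / 2 * sqrt (a ^ 2 - 4 * c * t ^ 2))
      - s * (a ^ 2 / (4 * sqrt (- c))
             * ln (2 * sqrt (- c) * t + sqrt (a ^ 2 - 4 * c * t ^ 2))))).
  { intros x; rewrite (Rabs_pos_eq _ (Rlt_le _ _ (pos x))); reflexivity. }
  specialize (pos t).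
  auto_derive.
  + replace (a * (a * 1) + - (4 * c * (t * (t * 1)))) with (a ^ 2 - 4 * c * t ^ 2) by ring.
    repeat split; auto.
  + replace (a * (a * 1) + - (4 * c * (t * (t * 1)))) with (a ^ 2 - 4 * c * t ^ 2) by ring.
    assert (a2 : a ^ 2 = sqrt (a ^ 2 - 4 * c * t ^ 2) ^ 2 - 4 * sqrt (- c) ^ 2 * t ^ 2)
      by (rewrite sc2, sq2; ring).
    set (q := sqrt (a ^ 2 - _)) in *. set (k := sqrt (- c)) in *.
    replace (a * (a * 1)) with (a ^ 2) by ring. rewrite a2.
    replace c with (- k ^ 2) by lra.
    field; lra.
Qed.

(** * The geometry of meridian surfaces *)

Lemma plus_E42 (a1 a2 a3 a4 b1 b2 b3 b4 : R) :
  plus ((a1, a2, a3, a4) : E42) (b1, b2, b3, b4) = (a1 + b1, a2 + b2, a3 + b3, a4 + b4).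
Proof. reflexivity. Qed.

Lemma minus_E42 (a1 a2 a3 a4 b1 b2 b3 b4 : R) :
  minus ((a1, a2, a3, a4) : E42) (b1, b2, b3, b4) = (a1 - b1, a2 - b2, a3 - b3, a4 - b4).
Proof. reflexivity. Qed.

Lemma scal_E42 (k a1 a2 a3 a4 : R) :
  scal k ((a1, a2, a3, a4) : E42) = (k * a1, k * a2, k * a3, k * a4).
Proof. reflexivity. Qed.

Lemma E42_eq (a1 a2 a3 a4 b1 b2 b3 b4 : R) :
  a1 = b1 -> a2 = b2 -> a3 = b3 -> a4 = b4 -> (a1, a2, a3, a4) = (b1, b2, b3, b4) :> E42.
Proof. now intros -> -> -> ->. Qed.

Ltac coords := repeat (rewrite plus_E42 || rewrite minus_E42 || rewrite scal_E42).

Ltac E42_ring :=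
  coords; apply E42_eq;
  match goal with |- ?a = ?b => change (a = b :> R) end; ring.

Lemma inner_coords (x y : E42) :
  inner x y = coord1 x * coord1 y + coord2 x * coord2 y
              - coord3 x * coord3 y - coord4 x * coord4 y.
Proof. now destruct x as [[[x1 x2] x3] x4], y as [[[y1 y2] y3] y4]. Qed.

Lemma inner_sym (x y : E42) : inner x y = inner y x.
Proof. rewrite !inner_coords; ring. Qed.

Lemma inner_plus_l (x y w : E42) : inner (plus x y) w = inner x w + inner y w.
Proof.
destruct x as [[[x1 x2] x3] x4], y as [[[y1 y2] y3] y4], w as [[[w1 w2] w3] w4].
coords; simpl; ring.
Qed.

Lemma inner_scal_l (k : R) (x w : E42) : inner (scal k x) w = k * inner x w.
Proof.
destruct x as [[[x1 x2] x3] x4], w as [[[w1 w2] w3] w4].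
coords; simpl; ring.
Qed.

Lemma inner_plus_r (x y w : E42) : inner w (plus x y) = inner w x + inner w y.
Proof. now rewrite !(inner_sym w), inner_plus_l. Qed.

Lemma inner_scal_r (k : R) (x w : E42) : inner w (scal k x) = k * inner w x.
Proof. now rewrite !(inner_sym w), inner_scal_l. Qed.

Lemma inner_e4 (x : E42) : inner x e4 = - coord4 x.
Proof. rewrite inner_coords; unfold e4, coord1, coord2, coord3, coord4; simpl; ring. Qed.

Lemma inner_e4_l (x : E42) : inner e4 x = - coord4 x.
Proof. now rewrite inner_sym, inner_e4. Qed.

Lemma coord4_e4 : coord4 e4 = 1.
Proof. reflexivity. Qed.

(** For orthogonal [x] and [y] the Gram system decouples, the coefficients [A] and [B] become those
    of the separate projections, and Pythagoras applies. *)
Lemma inner_normal_part (x y w : E42) :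
  inner x y = 0 -> inner x x <> 0 -> inner y y <> 0 ->
  inner (normal_part x y w) (normal_part x y w)
  = inner w w - inner w x ^ 2 / inner x x - inner w y ^ 2 / inner y y.
Proof.
intros xy xx yy; unfold normal_part; rewrite xy.
set (A := (_ / _)); set (B := (_ / _)).
assert (HA : A = inner w x / inner x x) by (unfold A; field; auto).
assert (HB : B = inner w y / inner y y) by (unfold B; field; auto).
replace (minus w (plus (scal A x) (scal B y)))
  with (plus w (plus (scal (- A) x) (scal (- B) y))).
2: { destruct x as [[[x1 x2] x3] x4], y as [[[y1 y2] y3] y4], w as [[[w1 w2] w3] w4].
     E42_ring. }
rewrite !inner_plus_l, !inner_plus_r, !inner_scal_l, !inner_scal_r.
rewrite (inner_sym y x), (inner_sym x w), (inner_sym y w), xy, HA, HB.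
field; auto.
Qed.

(* An orthonormal frame diagonalizes the metric, so that [E1 (x) E1 - E2 (x) E2] is the
   inverse metric and the trace does not depend on the frame. *)
Lemma mean_curvature_vector_orthogonal (z : R -> R -> E42) (u v : R) (E1 E2 : R * R) (r : R) :
  r <> 0 -> inner (z_u z u v) (z_u z u v) = -1 -> inner (z_u z u v) (z_v z u v) = 0 ->
  inner (z_v z u v) (z_v z u v) = r ^ 2 -> orthonormal_frame z u v E1 E2 ->
  mean_curvature_vector z u v E1 E2
  = scal (1 / 2) (normal_part (z_u z u v) (z_v z u v)
      (plus (scal (-1) (z_uu z u v)) (scal (/ r ^ 2) (z_vv z u v)))).
Proof.
intros r0 uu uv vv [H1 [H2 H12]].
destruct E1 as [p1 q1], E2 as [p2 q2].
unfold tangent in *; simpl fst in *; simpl snd in *.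
rewrite !inner_plus_l, !inner_plus_r, !inner_scal_l, !inner_scal_r in H1, H2, H12.
rewrite (inner_sym (z_v z u v) (z_u z u v)), uu, uv, vv in H1, H2, H12.
assert (P1 : (r * q1) ^ 2 = 1 + p1 ^ 2) by lra.
assert (P2 : (r * q2) ^ 2 = p2 ^ 2 - 1) by lra.
assert (P12 : (r * q1) * (r * q2) = p1 * p2) by lra.
(* [D], [M] and [N] are the entries of the inverse metric diag(-1, 1/r^2) in the basis [z_u], [z_v].
   The first comes from multiplying [P1] by [P2] and comparing with the square of [P12]. *)
assert (D : p1 ^ 2 - p2 ^ 2 = -1).
{ assert ((1 + p1 ^ 2) * (p2 ^ 2 - 1) = (p1 * p2) ^ 2); [|lra].
  rewrite <- P1, <- P2, <- P12; ring. }
assert (M : p1 * q1 - p2 * q2 = 0).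
{ assert (M2 : (r * (p1 * q1 - p2 * q2)) ^ 2 = 0).
  { transitivity (p1 ^ 2 * (r * q1) ^ 2 + p2 ^ 2 * (r * q2) ^ 2
                  - 2 * (p1 * p2) * ((r * q1) * (r * q2))); [ring|].
    rewrite P1, P2, P12.
    replace (p1 ^ 2) with (p2 ^ 2 - 1) by lra.
    transitivity (2 * p2 ^ 2 * (p2 ^ 2 - 1) - 2 * (p1 ^ 2) * p2 ^ 2); [ring|].
    replace (p1 ^ 2) with (p2 ^ 2 - 1) by lra; ring. }
  assert (M1 : r * (p1 * q1 - p2 * q2) = 0).
  { apply Rsqr_0_uniq; unfold Rsqr; lra. }
  apply Rmult_integral in M1 as [M1|M1]; [easy|exact M1]. }
assert (N : q1 ^ 2 - q2 ^ 2 = / r ^ 2).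
{ apply (Rmult_eq_reg_l (r ^ 2)); [|now apply pow_nonzero].
  rewrite Rinv_r by (now apply pow_nonzero). nra. }
unfold mean_curvature_vector, second_form; simpl fst; simpl snd.
rewrite <- D, <- N.
replace (plus (scal (p1 ^ 2 - p2 ^ 2) (z_uu z u v)) (scal (q1 ^ 2 - q2 ^ 2) (z_vv z u v)))
  with (plus (scal (p1 ^ 2 - p2 ^ 2) (z_uu z u v))
       (plus (scal (2 * (p1 * q1 - p2 * q2)) (z_uv z u v))
             (scal (q1 ^ 2 - q2 ^ 2) (z_vv z u v)))).
2: { rewrite M.
     destruct (z_uu z u v) as [[[a1 a2] a3] a4], (z_uv z u v) as [[[b1 b2] b3] b4],
       (z_vv z u v) as [[[c1 c2] c3] c4].
     E42_ring. }
f_equal.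
(* What remains is the linearity of [normal_part] in its last argument. Once the inner products and
   the inverse Gram determinant are opaque scalars, it is a polynomial identity in each
   coordinate. *)
unfold normal_part.
rewrite !inner_plus_l, !inner_scal_l.
unfold Rdiv.
generalize (/ (inner (z_u z u v) (z_u z u v) * inner (z_v z u v) (z_v z u v) -
     inner (z_u z u v) (z_v z u v) ^ 2)); intros D'.
repeat match goal with |- context [inner ?x ?y] =>
  let i := fresh "i" in generalize (inner x y); intros i end.
destruct (z_uu z u v) as [[[a1 a2] a3] a4], (z_uv z u v) as [[[b1 b2] b3] b4],
  (z_vv z u v) as [[[c1 c2] c3] c4], (z_u z u v) as [[[d1 d2] d3] d4],
  (z_v z u v) as [[[f1 f2] f3] f4].
E42_ring.
Qed.

(** * Curves in the three-dimensional subspace and on the hyperboloid *)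

Lemma in_H21_E31 (x : E42) : in_H21 x -> coord4 x = 0.
Proof. now intros [[H _] _]. Qed.

Lemma in_H21_inner (x : E42) : in_H21 x -> inner x x = -1.
Proof. now intros [[_ H] _]. Qed.

Lemma smooth_curve_Dcurve (J : R -> Prop) (l : R -> E42) :
  smooth_curve_on J l -> smooth_curve_on J (Dcurve l).
Proof. intros [H1 [H2 [H3 H4]]]; repeat split; now apply smooth_on_Derive. Qed.

Lemma is_derive_inner (J : R -> Prop) (A B : R -> E42) (v : R) :
  smooth_curve_on J A -> smooth_curve_on J B -> J v ->
  is_derive (fun s => inner (A s) (B s)) v
    (inner (Dcurve A v) (B v) + inner (A v) (Dcurve B v)).
Proof.
intros [A1 [A2 [A3 A4]]] [B1 [B2 [B3 B4]]] Jv.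
apply (is_derive_ext (fun s =>
  coord1 (A s) * coord1 (B s) + coord2 (A s) * coord2 (B s)
  - coord3 (A s) * coord3 (B s) - coord4 (A s) * coord4 (B s))).
{ intros t; now rewrite inner_coords. }
(* The coordinates are abstracted to function variables, which [auto_derive] treats as atoms. *)
assert (K : forall a1 a2 a3 a4 b1 b2 b3 b4 : R -> R,
  ex_derive a1 v -> ex_derive a2 v -> ex_derive a3 v -> ex_derive a4 v ->
  ex_derive b1 v -> ex_derive b2 v -> ex_derive b3 v -> ex_derive b4 v ->
  is_derive (fun s => a1 s * b1 s + a2 s * b2 s - a3 s * b3 s - a4 s * b4 s) v
    (inner (Derive a1 v, Derive a2 v, Derive a3 v, Derive a4 v) (b1 v, b2 v, b3 v, b4 v)
     + inner (a1 v, a2 v, a3 v, a4 v) (Derive b1 v, Derive b2 v, Derive b3 v, Derive b4 v))).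
{ intros; auto_derive; [tauto|]. derive_eta; simpl; ring. }
rewrite (inner_coords (Dcurve A v)), (inner_coords (A v)).
apply K; now apply (smooth_on_ex_derive J).
Qed.

Lemma smooth_curve_E31_Dcurve (J : R -> Prop) (l : R -> E42) (v : R) :
  is_interval J -> smooth_curve_on J l -> (forall s, J s -> coord4 (l s) = 0) -> J v ->
  coord4 (Dcurve l v) = 0.
Proof.
intros HJ [_ [_ [_ l4]]] l0 Jv.
apply (interval_derive_zero J (fun s => coord4 (l s)) v); auto.
now apply Derive_correct, (smooth_on_ex_derive J).
Qed.

(* Parseval's identity. The matrix with rows [l], [t], [n] has determinant of square 1,
   so the component of [w] orthogonal to them is 0. *)
Lemma inner_orthonormal_E31 (l t n w : E42) :
  coord4 l = 0 -> coord4 t = 0 -> coord4 n = 0 -> coord4 w = 0 ->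
  inner l l = -1 -> inner t t = 1 -> inner n n = 1 ->
  inner l t = 0 -> inner n l = 0 -> inner n t = 0 ->
  inner w w = - inner w l ^ 2 + inner w t ^ 2 + inner w n ^ 2.
Proof.
intros l4 t4 n4 w4 ll tt nn lt nl nt.
assert (D : forall d : E42, coord4 d = 0 -> inner d l = 0 -> inner d t = 0 -> inner d n = 0 ->
  inner d d = 0).
{ destruct l as [[[l1 l2] l3] l4'], t as [[[t1 t2] t3] t4'], n as [[[n1 n2] n3] n4'].
  unfold coord4 in *; simpl in l4, t4, n4; subst.
  intros [[[d1 d2] d3] d4]; simpl in *; intros -> dl dt dn.
  set (M := l1 * (t2 * n3 - t3 * n2) - l2 * (t1 * n3 - t3 * n1) + l3 * (t1 * n2 - t2 * n1)).
  (* The metric has determinant -1 on the subspace, so the Gram determinant of the three vectors is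
     - M^2; by orthonormality it is also -1. *)
  assert (M2 : M ^ 2 = 1).
  { pose (a := l1 * l1 + l2 * l2 - l3 * l3). pose (b := t1 * t1 + t2 * t2 - t3 * t3).
    pose (c := n1 * n1 + n2 * n2 - n3 * n3). pose (d := l1 * t1 + l2 * t2 - l3 * t3).
    pose (e := n1 * l1 + n2 * l2 - n3 * l3). pose (f := n1 * t1 + n2 * t2 - n3 * t3).
    transitivity (- (a * (b * c - f * f) - d * (d * c - f * e) + e * (d * f - b * e))).
    - unfold M, a, b, c, d, e, f; ring.
    - replace a with (-1) by (unfold a; lra). replace b with 1 by (unfold b; lra).
      replace c with 1 by (unfold c; lra). replace d with 0 by (unfold d; lra).
      replace e with 0 by (unfold e; lra). replace f with 0 by (unfold f; lra). ring. }
  pose (x := d1 * l1 + d2 * l2 - d3 * l3). pose (y := d1 * t1 + d2 * t2 - d3 * t3).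
  pose (z := d1 * n1 + d2 * n2 - d3 * n3).
  assert (x0 : x = 0) by (unfold x; lra). assert (y0 : y = 0) by (unfold y; lra).
  assert (z0 : z = 0) by (unfold z; lra).
  (* Cramer's rule for the homogeneous system x = y = z = 0 in the coordinates of [d]. *)
  assert (E1 : M * d1 = 0).
  { transitivity (x * (t2 * n3 - t3 * n2) - y * (l2 * n3 - l3 * n2) + z * (l2 * t3 - l3 * t2)).
    - unfold M, x, y, z; ring.
    - rewrite x0, y0, z0; ring. }
  assert (E2 : M * d2 = 0).
  { transitivity (- x * (t1 * n3 - t3 * n1) + y * (l1 * n3 - l3 * n1) - z * (l1 * t3 - l3 * t1)).
    - unfold M, x, y, z; ring.
    - rewrite x0, y0, z0; ring. }
  assert (E3 : M * d3 = 0).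
  { transitivity (- (x * (t1 * n2 - t2 * n1) - y * (l1 * n2 - l2 * n1) + z * (l1 * t2 - l2 * t1))).
    - unfold M, x, y, z; ring.
    - rewrite x0, y0, z0; ring. }
  transitivity (M ^ 2 * (d1 * d1 + d2 * d2 - d3 * d3 - 0 * 0)); [rewrite M2; ring|].
  transitivity ((M * d1) ^ 2 + (M * d2) ^ 2 - (M * d3) ^ 2); [ring|].
  rewrite E1, E2, E3; ring. }
(* The difference between [w] and its expansion in the frame; the coefficient of [l] has the
   opposite sign because <l,l> = -1. *)
set (d := plus w (plus (scal (inner w l) l) (plus (scal (- inner w t) t) (scal (- inner w n) n)))).
assert (d0 : inner d d = 0).
{ apply D.
  - rewrite <- (Ropp_involutive (coord4 d)), <- inner_e4; unfold d.
    rewrite !inner_plus_l, !inner_scal_l, !inner_e4, l4, t4, n4, w4; ring.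
  - unfold d; rewrite !inner_plus_l, !inner_scal_l, (inner_sym t l), ll, lt, nl; ring.
  - unfold d; rewrite !inner_plus_l, !inner_scal_l, lt, nt, tt; ring.
  - unfold d; rewrite !inner_plus_l, !inner_scal_l, (inner_sym l n), (inner_sym t n), nn, nt, nl; ring. }
unfold d in d0.
rewrite !inner_plus_l, !inner_plus_r, !inner_scal_l, !inner_scal_r in d0.
rewrite (inner_sym t l), (inner_sym l n), (inner_sym t n), ?(inner_sym l w), ?(inner_sym t w),
  ?(inner_sym n w), ll, tt, nn, lt, nl, nt in d0.
lra.
Qed.

(** * Derivatives of curves of the form p A + q e4 *)

Lemma coord_scal (k : R) (x : E42) :
  coord1 (scal k x) = k * coord1 x /\ coord2 (scal k x) = k * coord2 x /\
  coord3 (scal k x) = k * coord3 x /\ coord4 (scal k x) = k * coord4 x.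
Proof. now destruct x as [[[x1 x2] x3] x4]. Qed.

Lemma E42_coord_eq (x y : E42) :
  coord1 x = coord1 y -> coord2 x = coord2 y -> coord3 x = coord3 y ->
  coord4 x = coord4 y -> x = y.
Proof.
destruct x as [[[x1 x2] x3] x4], y as [[[y1 y2] y3] y4]; unfold coord1, coord2, coord3, coord4.
simpl; now intros -> -> -> ->.
Qed.

Lemma coord_meridian (k m : R) (x : E42) :
  coord1 (plus (scal k x) (scal m e4)) = k * coord1 x /\
  coord2 (plus (scal k x) (scal m e4)) = k * coord2 x /\
  coord3 (plus (scal k x) (scal m e4)) = k * coord3 x /\
  coord4 (plus (scal k x) (scal m e4)) = k * coord4 x + m.
Proof.
destruct x as [[[x1 x2] x3] x4]; unfold e4; coords.
unfold coord1, coord2, coord3, coord4; simpl; repeat split; ring.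
Qed.

Lemma Dcurve_ext (A B : R -> E42) (u : R) :
  (forall s, A s = B s) -> Dcurve A u = Dcurve B u.
Proof.
intros AB; unfold Dcurve; apply E42_eq; apply Derive_ext; intros s; now rewrite AB.
Qed.

(** No derivability is assumed: the difference quotients coincide, and [Derive] is the total
    function given by their limit. *)
Lemma Derive_plus_const (p : R -> R) (k u : R) :
  Derive (fun s => p s + k) u = Derive p u.
Proof.
unfold Derive; f_equal; apply Lim_ext; intros h; unfold Rdiv; ring.
Qed.

(* [p] and [q] need not be derivable: each coordinate is a multiple of one of them. *)
Lemma Dcurve_meridian_u (p q : R -> R) (A : E42) (u : R) :
  coord4 A = 0 ->
  Dcurve (fun s => plus (scal (p s) A) (scal (q s) e4)) u
  = plus (scal (Derive p u) A) (scal (Derive q u) e4).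
Proof.
intros A4; apply E42_coord_eq;
  [pose proof (fun k m => proj1 (coord_meridian k m A)) as C
  |pose proof (fun k m => proj1 (proj2 (coord_meridian k m A))) as C
  |pose proof (fun k m => proj1 (proj2 (proj2 (coord_meridian k m A)))) as C
  |pose proof (fun k m => proj2 (proj2 (proj2 (coord_meridian k m A)))) as C];
  rewrite C; unfold Dcurve at 1; unfold coord1 at 1, coord2 at 1, coord3 at 1, coord4 at 1;
  cbn [fst snd].
1-3: rewrite (Derive_ext _ _ _ (fun s => C (p s) (q s))); apply Derive_scal_l.
rewrite A4, Rmult_0_r, Rplus_0_l; apply Derive_ext; intros s; rewrite C, A4; ring.
Qed.

Lemma Dcurve_meridian_v (k m : R) (A : R -> E42) (v : R) :
  Dcurve (fun s => plus (scal k (A s)) (scal m e4)) v = scal k (Dcurve A v).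
Proof.
destruct (coord_scal k (Dcurve A v)) as [S1 [S2 [S3 S4]]].
apply E42_coord_eq; [rewrite S1|rewrite S2|rewrite S3|rewrite S4];
  unfold Dcurve; unfold coord1 at 1, coord2 at 1, coord3 at 1, coord4 at 1; cbn [fst snd].
- rewrite (Derive_ext _ _ _ (fun s => proj1 (coord_meridian k m (A s)))).
  apply Derive_scal.
- rewrite (Derive_ext _ _ _ (fun s => proj1 (proj2 (coord_meridian k m (A s))))).
  apply Derive_scal.
- rewrite (Derive_ext _ _ _ (fun s => proj1 (proj2 (proj2 (coord_meridian k m (A s)))))).
  apply Derive_scal.
- rewrite (Derive_ext _ _ _ (fun s => proj2 (proj2 (proj2 (coord_meridian k m (A s)))))).
  rewrite Derive_plus_const; apply Derive_scal.
Qed.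

Lemma Dcurve_scal (k : R) (A : R -> E42) (v : R) :
  Dcurve (fun s => scal k (A s)) v = scal k (Dcurve A v).
Proof.
rewrite <- (Dcurve_meridian_v k 0); apply Dcurve_ext; intros s.
destruct (A s) as [[[a1 a2] a3] a4]; unfold e4; E42_ring.
Qed.

(** By f'^2 + g'^2 = 1, the curvature f' g'' - f'' g' of the meridian equals - f'' / g'; thus W is
    g' plus [f] times this curvature. *)
Definition meridian_W (f g : R -> R) (u : R) : R :=
  Derive g u - f u * Derive (Derive f) u / Derive g u.

(** The conditions of [is_meridian_data] that concern the meridian alone, so that its differential
    equation can be studied without [l]. *)
Record is_meridian_curve (I : R -> Prop) (f g : R -> R) : Prop := {
  mc_I : is_interval I;
  mc_f : smooth_on I f;
  mc_g : smooth_on I g;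
  mc_f_neq0 : forall u, I u -> f u <> 0;
  mc_arc : forall u, I u -> Derive f u ^ 2 + Derive g u ^ 2 = 1;
  mc_g'_pos : forall u, I u -> 0 < Derive g u
}.

Lemma meridian_data_curve (I J : R -> Prop) (f g : R -> R) (l : R -> E42) :
  is_meridian_data I J f g l -> is_meridian_curve I f g.
Proof. now intros []. Qed.

Lemma meridian_acceleration (I : R -> Prop) (f g : R -> R) (u : R) :
  is_meridian_curve I f g -> I u ->
  Derive f u * Derive (Derive f) u + Derive g u * Derive (Derive g) u = 0.
Proof.
intros [HI Hf Hg _ arc _] Iu.
assert (E : 2 * (Derive f u * Derive (Derive f) u + Derive g u * Derive (Derive g) u) = 0).
{ apply (interval_derive_eq I (fun x => Derive f x ^ 2 + Derive g x ^ 2) (fun _ => 1) u); auto.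
  - pose proof (smooth_on_ex_derive _ _ _ (smooth_on_Derive _ _ Hf) Iu).
    pose proof (smooth_on_ex_derive _ _ _ (smooth_on_Derive _ _ Hg) Iu).
    auto_derive; [tauto|derive_eta; ring].
  - auto_derive; auto. }
lra.
Qed.

(** Differentiating <l,l> = -1 gives <l,l'> = 0; differentiating that gives <l'',l> = - <l',l'> =
    -1; differentiating <l',l'> = 1 gives <l'',l'> = 0. *)
Lemma curve_Gram (I J : R -> Prop) (f g : R -> R) (l : R -> E42) (v : R) :
  is_meridian_data I J f g l -> J v ->
  inner (l v) (l v) = -1 /\ inner (l v) (Dcurve l v) = 0 /\
  inner (Dcurve (Dcurve l) v) (l v) = -1 /\ inner (Dcurve (Dcurve l) v) (Dcurve l v) = 0.
Proof.
intros [_ HJ _ _ _ _ _ Hl lH lt] Jv.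
pose proof (smooth_curve_Dcurve _ _ Hl) as Hl'.
assert (ll' : forall s, J s -> inner (l s) (Dcurve l s) = 0).
{ intros s Js.
  assert (E : inner (Dcurve l s) (l s) + inner (l s) (Dcurve l s) = 0).
  { apply (interval_derive_eq J (fun x => inner (l x) (l x)) (fun _ => -1) s); auto.
    - intros x Jx; now apply in_H21_inner, lH.
    - now apply (is_derive_inner J).
    - auto_derive; auto. }
  rewrite (inner_sym (Dcurve l s)) in E; lra. }
repeat split; auto.
- now apply in_H21_inner, lH.
- assert (E : inner (Dcurve l v) (Dcurve l v) + inner (l v) (Dcurve (Dcurve l) v) = 0).
  { apply (interval_derive_eq J (fun x => inner (l x) (Dcurve l x)) (fun _ => 0) v); auto.
    - now apply (is_derive_inner J).
    - auto_derive; auto. }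
  rewrite lt, (inner_sym (l v)) in E by auto; lra.
- assert (E : inner (Dcurve (Dcurve l) v) (Dcurve l v)
              + inner (Dcurve l v) (Dcurve (Dcurve l) v) = 0).
  { apply (interval_derive_eq J (fun x => inner (Dcurve l x) (Dcurve l x)) (fun _ => 1) v); auto.
    - now apply (is_derive_inner J).
    - auto_derive; auto. }
  rewrite (inner_sym (Dcurve l v)) in E; lra.
Qed.

Lemma curve_E31 (I J : R -> Prop) (f g : R -> R) (l : R -> E42) (v : R) :
  is_meridian_data I J f g l -> J v ->
  coord4 (l v) = 0 /\ coord4 (Dcurve l v) = 0 /\ coord4 (Dcurve (Dcurve l) v) = 0.
Proof.
intros [_ HJ _ _ _ _ _ Hl lH _] Jv.
assert (l4 : forall s, J s -> coord4 (l s) = 0) by (intros s Js; now apply in_H21_E31, lH).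
assert (l4' : forall s, J s -> coord4 (Dcurve l s) = 0).
{ intros s Js; now apply (smooth_curve_E31_Dcurve J). }
repeat split; auto.
apply (smooth_curve_E31_Dcurve J); auto; now apply smooth_curve_Dcurve.
Qed.

(** Parseval's identity for l'' = kappa n + l, where <l,l> = -1. *)
Lemma curvature_squared (I J : R -> Prop) (f g : R -> R) (l n : R -> E42) (v : R) :
  is_meridian_data I J f g l -> is_unit_normal J l n -> J v ->
  inner (Dcurve (Dcurve l) v) (Dcurve (Dcurve l) v) = kappa l n v ^ 2 - 1.
Proof.
intros md [_ n4 nn nl nt] Jv.
destruct (curve_E31 _ _ _ _ _ _ md Jv) as [l4 [t4 a4]].
destruct (curve_Gram _ _ _ _ _ _ md Jv) as [ll [lt [al at_]]].
rewrite (inner_orthonormal_E31 (l v) (Dcurve l v) (n v)); auto.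
- rewrite al, at_; unfold kappa; ring.
- now apply n4.
- now apply (md_l_unit _ _ _ _ _ md).
Qed.

Lemma ex_derive_kappa (I J : R -> Prop) (f g : R -> R) (l n : R -> E42) (v : R) :
  is_meridian_data I J f g l -> is_unit_normal J l n -> J v -> ex_derive (kappa l n) v.
Proof.
intros md un Jv; eexists; apply (is_derive_inner J); auto.
- now apply smooth_curve_Dcurve, smooth_curve_Dcurve, (md_l_smooth _ _ _ _ _ md).
- now apply (un_smooth _ _ _ un).
Qed.

(** * Partial derivatives, first form and mean curvature of the surface *)

Lemma meridian_z_u (f g : R -> R) (l : R -> E42) (u v : R) :
  coord4 (l v) = 0 ->
  z_u (meridian_surface f g l) u v = plus (scal (Derive f u) (l v)) (scal (Derive g u) e4).
Proof. exact (Dcurve_meridian_u f g (l v) u). Qed.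

Lemma meridian_z_v (f g : R -> R) (l : R -> E42) (u v : R) :
  z_v (meridian_surface f g l) u v = scal (f u) (Dcurve l v).
Proof. exact (Dcurve_meridian_v (f u) (g u) l v). Qed.

Lemma meridian_z_uu (f g : R -> R) (l : R -> E42) (u v : R) :
  coord4 (l v) = 0 ->
  z_uu (meridian_surface f g l) u v
  = plus (scal (Derive (Derive f) u) (l v)) (scal (Derive (Derive g) u) e4).
Proof.
intros l4; rewrite <- Dcurve_meridian_u by easy.
apply Dcurve_ext; intros s; now apply meridian_z_u.
Qed.

Lemma meridian_z_vv (f g : R -> R) (l : R -> E42) (u v : R) :
  z_vv (meridian_surface f g l) u v = scal (f u) (Dcurve (Dcurve l) v).
Proof.
rewrite <- Dcurve_scal.
apply Dcurve_ext; intros s; apply meridian_z_v.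
Qed.

Lemma meridian_first_form (I J : R -> Prop) (f g : R -> R) (l : R -> E42) (u v : R) :
  is_meridian_data I J f g l -> I u -> J v ->
  let z := meridian_surface f g l in
  inner (z_u z u v) (z_u z u v) = -1 /\ inner (z_u z u v) (z_v z u v) = 0 /\
  inner (z_v z u v) (z_v z u v) = f u ^ 2.
Proof.
intros md Iu Jv z.
destruct (curve_E31 _ _ _ _ _ _ md Jv) as [l4 [t4 a4]].
destruct (curve_Gram _ _ _ _ _ _ md Jv) as [ll [lt [al at_]]].
pose proof (md_arclength _ _ _ _ _ md u Iu) as arc.
unfold z; rewrite meridian_z_u, meridian_z_v by easy.
rewrite !inner_plus_l, !inner_plus_r, !inner_scal_l, !inner_scal_r, !inner_e4, !inner_e4_l, coord4_e4.
rewrite l4, t4, ll, lt, (md_l_unit _ _ _ _ _ md v Jv).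
repeat split; lra.
Qed.

(** The frame (Y, X). [constant_mean_curvature] quantifies over all orthonormal frames, so one must
    be exhibited to extract information from it. *)
Lemma meridian_frame (I J : R -> Prop) (f g : R -> R) (l : R -> E42) (u v : R) :
  is_meridian_data I J f g l -> I u -> J v ->
  orthonormal_frame (meridian_surface f g l) u v (0, / f u) (1, 0).
Proof.
intros md Iu Jv.
destruct (meridian_first_form _ _ _ _ _ _ _ md Iu Jv) as [E [F G]].
pose proof (md_f_neq0 _ _ _ _ _ md u Iu) as f0.
unfold orthonormal_frame, tangent; cbn [fst snd].
rewrite !inner_plus_l, !inner_plus_r, !inner_scal_l, !inner_scal_r,
  (inner_sym (z_v _ u v) (z_u _ u v)), E, F, G.
repeat split; field; auto.
Qed.

Lemma meridian_mean_curvature (I J : R -> Prop) (f g : R -> R) (l n : R -> E42) (u v : R)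
    (E1 E2 : R * R) :
  is_meridian_data I J f g l -> is_unit_normal J l n -> I u -> J v ->
  orthonormal_frame (meridian_surface f g l) u v E1 E2 ->
  let H := mean_curvature_vector (meridian_surface f g l) u v E1 E2 in
  inner H H = (kappa l n v ^ 2 - meridian_W f g u ^ 2) / (4 * f u ^ 2).
Proof.
intros md un Iu Jv fr H.
destruct (curve_E31 _ _ _ _ _ _ md Jv) as [l4 [t4 a4]].
destruct (curve_Gram _ _ _ _ _ _ md Jv) as [ll [lt [al at_]]].
destruct (meridian_first_form _ _ _ _ _ _ _ md Iu Jv) as [E [F G]].
pose proof (curvature_squared _ _ _ _ _ _ _ md un Jv) as aa.
pose proof (meridian_acceleration _ _ _ _ (meridian_data_curve _ _ _ _ _ md) Iu) as acc.
pose proof (md_arclength _ _ _ _ _ md u Iu) as arc.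
pose proof (md_g'_pos _ _ _ _ _ md u Iu) as g0.
pose proof (md_f_neq0 _ _ _ _ _ md u Iu) as f0.
unfold H; rewrite (mean_curvature_vector_orthogonal _ _ _ _ _ (f u)); auto.
rewrite inner_scal_l, inner_scal_r, inner_normal_part; auto.
2: rewrite E; lra.
2: rewrite G; now apply pow_nonzero.
rewrite E, G.
rewrite meridian_z_u, meridian_z_v, meridian_z_uu, meridian_z_vv by easy.
rewrite !inner_plus_l, !inner_scal_l, !inner_plus_r, !inner_scal_r, !inner_plus_l, !inner_scal_l,
  !inner_plus_r, !inner_scal_r, !inner_e4, !inner_e4_l, coord4_e4.
rewrite (inner_sym (l v) (Dcurve (Dcurve l) v)), l4, t4, a4, ll, lt, al, at_, aa.
unfold meridian_W.
set (F0 := f u) in *. set (F1 := Derive f u) in *. set (F2 := Derive (Derive f) u) in *.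
set (G1 := Derive g u) in *. set (G2 := Derive (Derive g) u) in *.
assert (G2e : G2 = - F1 * F2 / G1) by (field_simplify_eq; lra).
(* The terms are grouped around f' f'' + g' g'', which vanishes by [acc], and f''^2 + g''^2, which
   [N] computes. With f'^2 = 1 - g'^2, the rest completes to the square of W. *)
transitivity ((kappa l n v ^ 2 - 1 + F1 ^ 2 + 2 * F0 * F2 - F0 ^ 2 * (F2 ^ 2 + G2 ^ 2)
  + F0 ^ 2 * (F1 * F2 + G1 * G2) ^ 2 - 2 * F0 * F1 * (F1 * F2 + G1 * G2)) / (4 * F0 ^ 2)).
- field; auto.
- assert (N : F2 ^ 2 + G2 ^ 2 = F2 ^ 2 / G1 ^ 2).
  { rewrite G2e. transitivity (F2 ^ 2 * (F1 ^ 2 + G1 ^ 2) / G1 ^ 2); [field; lra|].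
    rewrite arc; field; lra. }
  rewrite acc, N. replace (F1 ^ 2) with (1 - G1 ^ 2) by lra. field; split; lra.
Qed.

Lemma constant_mean_curvature_iff (I J : R -> Prop) (f g : R -> R) (l n : R -> E42) (c : R) :
  is_meridian_data I J f g l -> is_unit_normal J l n ->
  constant_mean_curvature I J (meridian_surface f g l) c <->
  (forall u v, I u -> J v ->
     kappa l n v ^ 2 = meridian_W f g u ^ 2 + 4 * c * f u ^ 2).
Proof.
intros md un; split.
- intros cmc u v Iu Jv.
  pose proof (meridian_frame _ _ _ _ _ _ _ md Iu Jv) as fr.
  pose proof (cmc u v Iu Jv _ _ fr) as E; cbv zeta in E.
  rewrite (meridian_mean_curvature _ _ _ _ _ _ _ _ _ _ md un Iu Jv fr) in E.
  rewrite <- E; field; exact (md_f_neq0 _ _ _ _ _ md u Iu).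
- intros E u v Iu Jv E1 E2 fr.
  cbv zeta; rewrite (meridian_mean_curvature _ _ _ _ _ _ _ _ _ _ md un Iu Jv fr).
  rewrite (E u v Iu Jv); field; exact (md_f_neq0 _ _ _ _ _ md u Iu).
Qed.

(** * The differential equation of the meridian *)

(** An explicit formula for the derivative of W: its own derivability at a point of [I], even an
    endpoint, follows from the smoothness of [f] and [g] there. *)
Definition meridian_W' (f g : R -> R) (u : R) : R :=
  let f1 := Derive f in let f2 := Derive f1 in let f3 := Derive f2 in
  let g1 := Derive g in let g2 := Derive g1 in
  g2 u - (f1 u * f2 u + f u * f3 u) / g1 u + f u * f2 u * g2 u / g1 u ^ 2.

Ltac meridian_smooth mc Iu :=
  pose proof (smooth_on_ex_derive _ _ _ (mc_f _ _ _ mc) Iu);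
  pose proof (smooth_on_ex_derive _ _ _ (smooth_on_Derive _ _ (mc_f _ _ _ mc)) Iu);
  pose proof (smooth_on_ex_derive _ _ _
    (smooth_on_Derive _ _ (smooth_on_Derive _ _ (mc_f _ _ _ mc))) Iu);
  pose proof (smooth_on_ex_derive _ _ _
    (smooth_on_Derive _ _ (smooth_on_Derive _ _ (smooth_on_Derive _ _ (mc_f _ _ _ mc)))) Iu);
  pose proof (smooth_on_ex_derive _ _ _ (mc_g _ _ _ mc) Iu);
  pose proof (smooth_on_ex_derive _ _ _ (smooth_on_Derive _ _ (mc_g _ _ _ mc)) Iu);
  pose proof (smooth_on_ex_derive _ _ _
    (smooth_on_Derive _ _ (smooth_on_Derive _ _ (mc_g _ _ _ mc))) Iu).

Lemma is_derive_meridian_W (I : R -> Prop) (f g : R -> R) (u : R) :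
  is_meridian_curve I f g -> I u -> is_derive (meridian_W f g) u (meridian_W' f g u).
Proof.
intros mc Iu; meridian_smooth mc Iu.
pose proof (mc_g'_pos _ _ _ mc u Iu) as g0.
unfold meridian_W, meridian_W'; auto_derive.
- repeat split; auto; lra.
- derive_eta; field; lra.
Qed.

Lemma ex_derive_meridian_W' (I : R -> Prop) (f g : R -> R) (u : R) :
  is_meridian_curve I f g -> I u -> ex_derive (meridian_W' f g) u.
Proof.
intros mc Iu; meridian_smooth mc Iu.
pose proof (mc_g'_pos _ _ _ mc u Iu) as g0.
unfold meridian_W'; auto_derive.
repeat split; auto; try lra. nra.
Qed.

(** In f' g' + f g'', substitute g'' = - f' f'' / g'. *)
Lemma is_derive_f_g' (I : R -> Prop) (f g : R -> R) (u : R) :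
  is_meridian_curve I f g -> I u ->
  is_derive (fun x => f x * Derive g x) u (Derive f u * meridian_W f g u).
Proof.
intros mc Iu; meridian_smooth mc Iu.
pose proof (mc_g'_pos _ _ _ mc u Iu) as g0.
pose proof (meridian_acceleration _ _ _ _ mc Iu) as acc.
auto_derive; [tauto|derive_eta].
unfold meridian_W.
replace (Derive (Derive g) u) with (- Derive f u * Derive (Derive f) u / Derive g u)
  by (field_simplify_eq; lra).
field; lra.
Qed.

(* At a zero of [W], differentiating [W^2 = k - 4 c f^2] once gives [f' = 0], hence
   [f f'' = 1]; differentiating twice gives [W'^2 = - 4 c]. *)
Lemma meridian_W_neq0 (I : R -> Prop) (f g : R -> R) (c k : R) :
  is_meridian_curve I f g -> c <> 0 -> (c < 0 -> 0 < k) ->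
  (forall u, I u -> meridian_W f g u ^ 2 = k - 4 * c * f u ^ 2) ->
  forall u, I u -> meridian_W f g u <> 0.
Proof.
intros mc c0 cn E u Iu W0.
pose proof (mc_f_neq0 _ _ _ mc u Iu) as f0.
(* For c < 0 the right side k - 4 c f^2 is positive, which already excludes a zero of W. *)
assert (c_pos : 0 < c).
{ destruct (Rlt_dec 0 c); [easy|exfalso].
  pose proof (E u Iu) as Eu; rewrite W0 in Eu.
  assert (0 < k) by (apply cn; lra). nra. }
assert (D1 : forall x, I x ->
  2 * meridian_W f g x * meridian_W' f g x = - 8 * c * f x * Derive f x).
{ intros x Ix; meridian_smooth mc Ix.
  pose proof (is_derive_meridian_W _ _ _ _ mc Ix) as dW.
  apply (interval_derive_eq I (fun y => meridian_W f g y ^ 2)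
    (fun y => k - 4 * c * f y ^ 2) x _ _ (mc_I _ _ _ mc) E Ix).
  - auto_derive; [now exists (meridian_W' f g x)|].
    derive_eta; rewrite (is_derive_unique _ _ _ dW); ring.
  - auto_derive; [tauto|derive_eta; ring]. }
meridian_smooth mc Iu.
assert (f1 : Derive f u = 0).
{ pose proof (D1 u Iu) as D; rewrite W0 in D.
  assert (c * f u * Derive f u = 0) as Z by lra.
  apply Rmult_integral in Z as [Z|Z]; [apply Rmult_integral in Z as [Z|Z]|]; easy. }
pose proof (mc_arc _ _ _ mc u Iu) as arc. rewrite f1 in arc.
pose proof (mc_g'_pos _ _ _ mc u Iu) as g0.
assert (g1 : Derive g u = 1) by nra.
assert (ff : f u * Derive (Derive f) u = 1).
{ unfold meridian_W in W0; rewrite g1 in W0; lra. }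
assert (D2 : 2 * meridian_W' f g u ^ 2 = - 8 * c).
{ pose proof (is_derive_meridian_W _ _ _ _ mc Iu) as dW.
  pose proof (ex_derive_meridian_W' _ _ _ _ mc Iu) as dW'.
  apply (interval_derive_eq I (fun x => 2 * meridian_W f g x * meridian_W' f g x)
    (fun x => - 8 * c * f x * Derive f x) u _ _ (mc_I _ _ _ mc) D1 Iu).
  - auto_derive; [split; [now exists (meridian_W' f g u)|split; [exact dW'|auto]]|].
    derive_eta; rewrite (is_derive_unique _ _ _ dW), W0; ring.
  - auto_derive; [tauto|derive_eta]. rewrite f1.
    transitivity (- 8 * c * (f u * Derive (Derive f) u)); [ring|rewrite ff; ring]. }
nra.
Qed.

(** [b] is the constant of integration: the integration is carried out with 0 in its place, and the
    value is supplied afterwards. *)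
Lemma phi_inner_shift (c a b s t : R) : phi_inner c a b s t = b + phi_inner c a 0 s t.
Proof. unfold phi_inner; destruct (Rlt_dec 0 c); ring. Qed.

Lemma meridian_W_determined (I : R -> Prop) (f g : R -> R) (c a : R) :
  is_meridian_curve I f g -> c <> 0 -> 0 < a ->
  (forall u, I u -> meridian_W f g u ^ 2 = a ^ 2 - 4 * c * f u ^ 2) ->
  meridian_determined I f g c a.
Proof.
intros mc c0 a0 E.
assert (q0 : forall u, I u -> 0 < a ^ 2 - 4 * c * f u ^ 2).
{ intros u Iu; rewrite <- E by easy; apply pow2_gt_0.
  apply (meridian_W_neq0 I f g c (a ^ 2)); auto. intros _; nra. }
(* The sign of W, written as a derivable quotient so that [interval_square_constant] shows it to be
   constant. *)
pose (rho u := meridian_W f g u / sqrt (a ^ 2 - 4 * c * f u ^ 2)).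
assert (rho2 : forall u, I u -> rho u ^ 2 = 1).
{ intros u Iu; unfold rho; specialize (q0 u Iu).
  pose proof (sqrt_lt_R0 _ q0) as sq0.
  transitivity (meridian_W f g u ^ 2 / sqrt (a ^ 2 - 4 * c * f u ^ 2) ^ 2); [field; lra|].
  rewrite pow2_sqrt, E by (auto; lra); field; lra. }
assert (rho_const : forall u w, I u -> I w -> rho u = rho w).
{ apply (interval_square_constant I rho 1); auto.
  - exact (mc_I _ _ _ mc).
  - intros u Iu; meridian_smooth mc Iu; specialize (q0 u Iu).
    pose proof (is_derive_meridian_W _ _ _ _ mc Iu) as dW.
    unfold rho; auto_derive.
    replace (a * (a * 1) + - (4 * c * (f u * (f u * 1))))
      with (a ^ 2 - 4 * c * f u ^ 2) by ring.
    split; [now exists (meridian_W' f g u)|]. repeat split; auto.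
    apply Rgt_not_eq, sqrt_lt_R0, q0. }
destruct (proj2 (mc_I _ _ _ mc)) as [x [_ [Ix _]]].
(* With this sign the derivative - s sqrt (a^2 - 4 c t^2) of [phi_inner] at t = f u is W, so [K]
   below has derivative 0; its value is the witness for [b]. *)
pose (s := - rho x).
pose (K u := f u * Derive g u - phi_inner c a 0 s (f u)).
assert (K_const : forall u w, I u -> I w -> K u = K w).
{ apply interval_derive_0_constant; [exact (mc_I _ _ _ mc)|].
  intros u Iu; meridian_smooth mc Iu; specialize (q0 u Iu).
  pose proof (sqrt_lt_R0 _ q0) as sq0.
  pose proof (is_derive_f_g' _ _ _ _ mc Iu) as d1.
  pose proof (is_derive_comp (phi_inner c a 0 s) f u _ _
    (is_derive_phi_inner c a 0 s (f u) c0 a0 q0) (Derive_correct f u H)) as d2.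
  pose proof (is_derive_minus _ _ _ _ _ d1 d2) as d.
  replace 0 with (minus (Derive f u * meridian_W f g u)
    (scal (Derive f u) (- s * sqrt (a ^ 2 - 4 * c * f u ^ 2)))); [exact d|].
  change (Derive f u * meridian_W f g u
    - Derive f u * (- s * sqrt (a ^ 2 - 4 * c * f u ^ 2)) = 0).
  unfold s; rewrite (rho_const x u) by easy; unfold rho; field; lra. }
exists (K x), s; split.
{ unfold is_sign, s; pose proof (rho2 x Ix) as r2.
  assert (Z : (rho x - 1) * (rho x + 1) = 0) by lra.
  apply Rmult_integral in Z as [Z|Z]; [right|left]; lra. }
intros u Iu.
pose proof (mc_f_neq0 _ _ _ mc u Iu) as f0.
pose proof (mc_arc _ _ _ mc u Iu) as arc.
pose proof (mc_g'_pos _ _ _ mc u Iu) as g0.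
assert (P : phi_inner c a (K x) s (f u) = f u * Derive g u).
{ rewrite phi_inner_shift, (K_const x u) by easy; unfold K; ring. }
(* The radicand in [phi] is the square of f f', so the outer sign is the sign of f f'. *)
assert (P2 : f u ^ 2 - phi_inner c a (K x) s (f u) ^ 2 = (f u * Derive f u) ^ 2).
{ rewrite P. replace ((f u * Derive f u) ^ 2) with (f u ^ 2 * Derive f u ^ 2) by ring.
  replace (Derive f u ^ 2) with (1 - Derive g u ^ 2) by lra. ring. }
split; [|split].
- repeat split; auto.
  + apply Rlt_le; auto.
  + rewrite P2; apply pow2_ge_0.
- unfold phi; rewrite P2, <- Rsqr_pow2, sqrt_Rsqr_abs.
  destruct (Rle_dec 0 (f u * Derive f u)).
  + exists 1; split; [now left|]. rewrite Rabs_pos_eq by easy; field; easy.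
  + exists (-1); split; [now right|]. rewrite Rabs_left by lra; field; easy.
- replace (1 - Derive f u ^ 2) with (Derive g u ^ 2) by lra.
  rewrite sqrt_pow2; lra.
Qed.

Lemma meridian_determined_W (I : R -> Prop) (f g : R -> R) (c a : R) :
  is_meridian_curve I f g -> c <> 0 -> 0 < a -> nonconstant_on I f ->
  meridian_determined I f g c a ->
  forall u, I u -> meridian_W f g u ^ 2 = a ^ 2 - 4 * c * f u ^ 2.
Proof.
intros mc c0 a0 [x [y [Ix [Iy fxy]]]] [b [s [s1 det]]].
pose proof (mc_I _ _ _ mc) as HI.
assert (s2 : s ^ 2 = 1) by (destruct s1 as [->| ->]; ring).
pose (q u := a ^ 2 - 4 * c * f u ^ 2).
pose (E u := meridian_W f g u ^ 2 - q u).
(* Squaring the equation f' = phi (f) removes the outer sign, which may vary with [u]. *)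
assert (P2 : forall u, I u -> phi_inner c a b s (f u) ^ 2 = (f u * Derive g u) ^ 2).
{ intros u Iu; destruct (det u Iu) as [[f0 [_ r0]] [[r [r1 fe]] _]].
  pose proof (mc_arc _ _ _ mc u Iu) as arc.
  assert (r2 : r ^ 2 = 1) by (destruct r1 as [->| ->]; ring).
  assert (F : f u ^ 2 * Derive f u ^ 2 = f u ^ 2 - phi_inner c a b s (f u) ^ 2).
  { rewrite fe; unfold phi.
    transitivity (r ^ 2 * sqrt (f u ^ 2 - phi_inner c a b s (f u) ^ 2) ^ 2).
    - field; easy.
    - rewrite r2, pow2_sqrt by easy; ring. }
  transitivity (f u ^ 2 - f u ^ 2 * Derive f u ^ 2); [lra|].
  replace (Derive f u ^ 2) with (1 - Derive g u ^ 2) by lra; ring. }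
assert (dq : forall u, I u -> is_derive q u (- 8 * c * f u * Derive f u)).
{ intros u Iu; meridian_smooth mc Iu; unfold q; auto_derive; [tauto|derive_eta; ring]. }
assert (dE : forall u, I u -> is_derive E u
  (2 * meridian_W f g u * meridian_W' f g u + 8 * c * f u * Derive f u)).
{ intros u Iu.
  pose proof (is_derive_meridian_W _ _ _ _ mc Iu) as dW.
  pose proof (dq u Iu) as dqu.
  unfold E; auto_derive.
  { split; [now exists (meridian_W' f g u)|].
    split; [now exists (- 8 * c * f u * Derive f u)|easy]. }
  derive_eta; rewrite (is_derive_unique _ _ _ dW), (is_derive_unique _ _ _ dqu); ring. }
(* The factor [q] covers the points where [q = 0], at which [phi_inner] need not be
   derivable; differentiating this identity there gives back [f' E = 0]. *)
assert (f'Eq : forall u, I u -> Derive f u * E u * q u = 0).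
{ intros u Iu.
  destruct (det u Iu) as [[f0 [q0 _]] _].
  destruct (Req_dec (q u) 0) as [->|qn]; [ring|].
  assert (qp : 0 < a ^ 2 - 4 * c * f u ^ 2) by (unfold q in qn; lra).
  meridian_smooth mc Iu.
  pose proof (is_derive_f_g' _ _ _ _ mc Iu) as d1.
  pose proof (is_derive_comp (phi_inner c a b s) f u _ _
    (is_derive_phi_inner c a b s (f u) c0 a0 qp) (Derive_correct f u H)) as d2.
  pose proof (pow2_sqrt _ (Rlt_le _ _ qp)) as sq2.
  set (Q := sqrt _) in *.
  pose (P := phi_inner c a b s (f u)). pose (G := f u * Derive g u).
  assert (D : 2 * P * (Derive f u * (- s * Q)) = 2 * G * (Derive f u * meridian_W f g u)).
  { apply (interval_derive_eq I (fun x => phi_inner c a b s (f x) ^ 2)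
      (fun x => (f x * Derive g x) ^ 2) u _ _ HI P2 Iu).
    - replace (2 * P * _) with (INR 2 * (Derive f u * (- s * Q)) * P ^ pred 2)
        by (simpl; ring).
      exact (is_derive_pow _ 2 _ _ d2).
    - replace (2 * G * _) with (INR 2 * (Derive f u * meridian_W f g u) * G ^ pred 2)
        by (simpl; ring).
      exact (is_derive_pow _ 2 _ _ d1). }
  assert (PG : P ^ 2 = G ^ 2) by exact (P2 u Iu).
  assert (G0 : G <> 0).
  { pose proof (mc_g'_pos _ _ _ mc u Iu). apply Rmult_integral_contrapositive; split; lra. }
  (* The square of [D], in which P^2 = G^2 and s^2 = 1 remove the unknown signs. *)
  assert (D2 : G ^ 2 * (Derive f u ^ 2 * E u) = 0).
  { assert (D3 : P ^ 2 * (Derive f u ^ 2 * (s ^ 2 * Q ^ 2))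
                = G ^ 2 * (Derive f u ^ 2 * meridian_W f g u ^ 2)).
    { transitivity ((P * (Derive f u * (- s * Q))) ^ 2); [ring|].
      replace (P * (Derive f u * (- s * Q))) with (G * (Derive f u * meridian_W f g u)) by lra.
      ring. }
    rewrite PG, s2, sq2 in D3. unfold E, q. lra. }
  apply Rmult_integral in D2 as [D2|D2]; [now apply pow_nonzero with (n := 2%nat) in G0|].
  apply Rmult_integral in D2 as [D2|D2]; [|rewrite D2; ring].
  rewrite (Rsqr_0_uniq (Derive f u)); [ring|unfold Rsqr; lra]. }
assert (f'E : forall u, I u -> Derive f u * E u = 0).
{ intros u Iu; meridian_smooth mc Iu.
  pose proof (dE u Iu) as dEu; pose proof (dq u Iu) as dqu.
  destruct (Req_dec (q u) 0) as [qz|qn].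
  2: { pose proof (f'Eq u Iu) as Z; apply Rmult_integral in Z as [Z|Z]; easy. }
  (* Where q = 0, the product rule applied to f' E q = 0 leaves only f' E q'. *)
  assert (D : Derive f u * E u * (- 8 * c * f u * Derive f u) = 0).
  { apply (interval_derive_zero I (fun x => Derive f x * E x * q x) u _ HI f'Eq Iu).
    auto_derive.
    - repeat split; auto; eexists; eassumption.
    - derive_eta; rewrite (is_derive_unique _ _ _ dqu), qz; ring. }
  pose proof (mc_f_neq0 _ _ _ mc u Iu) as f0.
  destruct (Req_dec (Derive f u) 0) as [->|n1]; [ring|].
  apply Rmult_integral in D as [D|D]; [easy|].
  apply Rmult_integral in D as [D|D]; [|easy].
  apply Rmult_integral in D as [D|D]; lra. }
(* Where E is not zero, h = 0, and differentiating h E = 0 leaves h' E = 0. Iterated from h = f',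
   this yields f'' E = 0 and f''' E = 0. *)
assert (step : forall h : R -> R, smooth_on I h -> (forall u, I u -> h u * E u = 0) ->
  forall u, I u -> Derive h u * E u = 0).
{ intros h hs hE u Iu.
  pose proof (smooth_on_ex_derive _ _ _ hs Iu).
  pose proof (dE u Iu) as dEu. set (E' := _ + _) in dEu.
  assert (D : Derive h u * E u + h u * E' = 0).
  { apply (interval_derive_zero I (fun x => h x * E x) u _ HI hE Iu).
    auto_derive.
    - repeat split; auto; eexists; eassumption.
    - derive_eta; rewrite (is_derive_unique _ _ _ dEu); ring. }
  pose proof (hE u Iu) as Z; apply Rmult_integral in Z as [Z|Z]; [rewrite Z in D; lra|].
  rewrite Z; ring. }
pose proof (smooth_on_Derive _ _ (mc_f _ _ _ mc)) as smooth1.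
pose proof (smooth_on_Derive _ _ smooth1) as smooth2.
pose proof (step _ smooth1 f'E) as f''E.
pose proof (step _ smooth2 f''E) as f'''E.
(* The square makes the derivative 2 E E' vanish trivially where E = 0. Elsewhere f', f'' and f'''
   vanish, hence also g'', W' and E'. *)
assert (E_const : forall u w, I u -> I w -> E u ^ 2 = E w ^ 2).
{ apply (interval_derive_0_constant I (fun u => E u ^ 2) HI).
  intros u Iu; pose proof (dE u Iu) as dEu.
  auto_derive; [eexists; eassumption|].
  derive_eta; rewrite (is_derive_unique _ _ _ dEu).
  destruct (Req_dec (E u) 0) as [->|En]; [ring|].
  pose proof (f'E u Iu) as Z1; pose proof (f''E u Iu) as Z2; pose proof (f'''E u Iu) as Z3.
  apply Rmult_integral in Z1 as [Z1|Z1]; [|easy].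
  apply Rmult_integral in Z2 as [Z2|Z2]; [|easy].
  apply Rmult_integral in Z3 as [Z3|Z3]; [|easy].
  pose proof (meridian_acceleration _ _ _ _ mc Iu) as acc.
  pose proof (mc_g'_pos _ _ _ mc u Iu) as g0.
  assert (g2 : Derive (Derive g) u = 0).
  { rewrite Z1, Rmult_0_l, Rplus_0_l in acc; apply Rmult_integral in acc as [Z|Z]; lra. }
  unfold meridian_W'; rewrite Z1, Z2, Z3, g2; field; lra. }
intros u Iu.
destruct (Req_dec (E u) 0) as [E0|En]; [unfold E, q in E0; lra|].
(* If E is non-zero at one point, it is non-zero on all of [I] because E^2 is constant; then f' = 0
   throughout, and [f] is constant. *)
exfalso; apply fxy, (interval_derive_0_constant I f HI); auto.
intros w Iw.
replace 0 with (Derive f w).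
- exact (Derive_correct _ _ (smooth_on_ex_derive _ _ _ (mc_f _ _ _ mc) Iw)).
- pose proof (f'E w Iw) as Z; apply Rmult_integral in Z as [Z|Z]; [easy|].
  exfalso; pose proof (E_const u w Iu Iw) as C; rewrite Z in C.
  apply En, Rsqr_0_uniq; unfold Rsqr; lra.
Qed.

(** * The two implications *)

Theorem theorem10
  (I J : R -> Prop) (f g : R -> R) (l n : R -> E42)
  (Hmeridian : is_meridian_data I J f g l)
  (Hnormal : is_unit_normal J l n)
  (c : R) (Hc : c <> 0) :
  ((c < 0 -> curvature_not_identically_0 J l n) ->
     constant_mean_curvature I J (meridian_surface f g l) c ->
     curvature_and_meridian I J f g l n c)
  /\
  (nonconstant_on I f ->
     curvature_and_meridian I J f g l n c ->
     constant_mean_curvature I J (meridian_surface f g l) c).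
Proof.
pose proof (meridian_data_curve _ _ _ _ _ Hmeridian) as mc.
pose proof (constant_mean_curvature_iff I J f g l n c Hmeridian Hnormal) as cmc.
split.
- intros not0 H; pose proof (proj1 cmc H) as E.
  destruct (proj2 (md_I _ _ _ _ _ Hmeridian)) as [u0 [_ [Iu0 _]]].
  destruct (proj2 (md_J _ _ _ _ _ Hmeridian)) as [v0 [_ [Jv0 _]]].
  assert (k_const : forall v w, J v -> J w -> kappa l n v = kappa l n w).
  { apply (interval_square_constant J _ (meridian_W f g u0 ^ 2 + 4 * c * f u0 ^ 2)).
    - exact (md_J _ _ _ _ _ Hmeridian).
    - intros v Jv; now apply (ex_derive_kappa I J f g).
    - intros v Jv; now apply E. }
  (* For c > 0, zero curvature would give 0 = W^2 + 4 c f^2 > 0; for c < 0, the constant [kappa] is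
     non-zero somewhere by hypothesis. *)
  assert (k0 : kappa l n v0 <> 0).
  { destruct (Rlt_dec c 0) as [cn|cp].
    - destruct (not0 cn) as [v [Jv kv]]; now rewrite (k_const v0 v).
    - intros Z; pose proof (E u0 v0 Iu0 Jv0) as E0; rewrite Z in E0.
      pose proof (pow2_gt_0 _ (mc_f_neq0 _ _ _ mc u0 Iu0)).
      pose proof (pow2_ge_0 (meridian_W f g u0)).
      assert (0 < c) by lra. nra. }
  exists (kappa l n v0); repeat split; auto.
  apply meridian_W_determined; auto using Rabs_pos_lt.
  intros u Iu; rewrite pow2_abs, (E u v0 Iu Jv0); ring.
- intros nonconst [a [a0 [ka det]]]; apply cmc; intros u v Iu Jv.
  rewrite (meridian_determined_W I f g c (Rabs a)), ka, pow2_abs; auto using Rabs_pos_lt; ring.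
Qed.
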